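(* Let $(M,\omega)$ be a connected symplectic manifold (open or closed). (i) Let $X,Y,Z\subset M$ be compact subsets with $X\cap Y\cap Z=\emptyset$. Then $$pb_3(X,Y,Z)=\inf_{(F,G)\in\mathcal F_3'(X,Y,Z)}\|\{F,G\}\|.$$ (ii) Let $X_0,X_1,Y_0,Y_1\subset M$ be compact subsets with $X_0\cap X_1=Y_0\cap Y_1=\emptyset$. Then $$pb_4(X_0,X_1,Y_0,Y_1)=\inf_{(F,G)\in\mathcal F_4'(X_0,X_1,Y_0,Y_1)}\|\{F,G\}\|.$$
   Context: $C^\infty_c(M)$ is the space of smooth compactly supported real functions on $M$ with the norm $\|F\|=\max_M|F|$; $\mathcal F=C_c^\infty(M)\times C_c^\infty(M)$. The Hamiltonian vector field of $F$ is given by $i_{\mathrm{sgrad}F}\,\omega=-dF$ and $\{F,G\}=\omega(\mathrm{sgrad}\,G,\mathrm{sgrad}\,F)$. For compact $X,Y,Z$ with $X\cap Y\cap Z=\emptyset$, $pb_3(X,Y,Z)=\inf\|\{F,G\}\|$ over all $(F,G)\in\mathcal F$ with $F|_X\le 0$, $G|_Y\le 0$, $(F+G)|_Z\ge 1$. For compact $X_0,X_1,Y_0,Y_1$ with $X_0\cap X_1=Y_0\cap Y_1=\emptyset$, $pb_4(X_0,X_1,Y_0,Y_1)=\inf\|\{F,G\}\|$ over all $(F,G)\in\mathcal F$ with $F|_{X_0}\le 0$, $F|_{X_1}\ge 1$, $G|_{Y_0}\le 0$, $G|_{Y_1}\ge 1$. $\mathcal F_3'(X,Y,Z)$ is the set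 of $(F,G)\in\mathcal F$ with $F\ge 0$, $G\ge 0$, $F+G\le 1$ on $M$, $F=0$ on some neighborhood of $X$, $G=0$ on some neighborhood of $Y$, and $F+G=1$ on some neighborhood of $Z$. $\mathcal F_4'(X_0,X_1,Y_0,Y_1)$ is the set of $(F,G)\in\mathcal F$ with $0\le F\le 1$, $0\le G\le 1$ on $M$, $F=0$ on some neighborhood of $X_0$, $F=1$ on some neighborhood of $X_1$, $G=0$ on some neighborhood of $Y_0$, $G=1$ on some neighborhood of $Y_1$. *)

(* Defs.v *)
From HB Require Import structures.
From mathcomp Require Import all_boot all_order all_algebra.
From mathcomp Require Import all_classical all_reals all_analysis.

Set Implicit Arguments.
Unset Strict Implicit.
Unset Printing Implicit Defensive.

Import Order.TTheory GRing.Theory Num.Theory.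
Import numFieldNormedType.Exports.

Local Open Scope classical_set_scope.
Local Open Scope ring_scope.

(* Meaningful for open U and finite-dimensional V: f is of class C^k on U.  Values
   of f outside U are irrelevant. *)
Fixpoint Ck_on (R : realType) (V W : normedModType R) (k : nat)
    (U : set V) (f : V -> W) : Prop :=
  match k with
  | 0 => forall x, U x -> {for x, continuous f}
  | k'.+1 => (forall x, U x -> differentiable f x) /\
             (forall v, Ck_on k' U (fun x => 'D_v f x))
  end.

Definition smooth_on (R : realType) (V W : normedModType R)
  (U : set V) (f : V -> W) : Prop := forall k, Ck_on k U f.

(* [to_vec] and [of_vec] are total functions that matter only on [dom] and [cod]
   respectively. *)
Record chart (R : realType) (n : nat) (M : topologicalType) := Chart {
  dom : set M;
  cod : set 'rV[R]_n;
  to_vec : M -> 'rV[R]_n;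
  of_vec : 'rV[R]_n -> M;
  dom_open : open dom;
  cod_open : open cod;
  to_vec_cod : forall p, dom p -> cod (to_vec p);
  of_vec_dom : forall x, cod x -> dom (of_vec x);
  to_vecK : forall p, dom p -> of_vec (to_vec p) = p;
  of_vecK : forall x, cod x -> to_vec (of_vec x) = x;
  to_vec_continuous : forall p, dom p -> {for p, continuous to_vec};
  of_vec_continuous : forall x, cod x -> {for x, continuous of_vec}
}.

Definition transition (R : realType) (n : nat) (M : topologicalType)
  (c d : chart R n M) : 'rV[R]_n -> 'rV[R]_n := to_vec d \o of_vec c.

Definition overlap (R : realType) (n : nat) (M : topologicalType)
  (c d : chart R n M) : set 'rV[R]_n := cod c `&` of_vec c @^-1` dom d.

(* An n-dimensional smooth manifold without boundary, compact or not; the smooth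
   structure is given by an atlas, not required to be maximal. *)
Record smooth_manifold (R : realType) (n : nat) (M : topologicalType) :=
  SmoothManifold {
  manifold_hausdorff : hausdorff_space M;
  manifold_second_countable : @second_countable M;
  charts : set (chart R n M);
  charts_cover : forall p, exists2 c, charts c & dom c p;
  charts_compatible : forall c d, charts c -> charts d ->
    smooth_on (overlap c d) (transition c d)
}.

Definition bilin (R : realType) (n : nat) (A : 'M[R]_n) (u v : 'rV[R]_n) : R :=
  (u *m A *m v^T) 0 0.

(* A symplectic form, given by its coefficient matrix [form_mx c x] at the point
   [x] of [cod c] for each chart c of the atlas.  [form_pullback] says that these
   local 2-forms agree on overlaps. *)
Record symplectic_form (R : realType) (n : nat) (M : topologicalType)
    (S : smooth_manifold R n M) := SymplecticForm {
  form_mx : chart R n M -> 'rV[R]_n -> 'M[R]_n;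
  form_smooth : forall c, charts S c -> smooth_on (cod c) (form_mx c);
  form_pullback : forall c d x u v, charts S c -> charts S d -> overlap c d x ->
    bilin (form_mx c x) u v =
    bilin (form_mx d (transition c d x))
      ('d (transition c d) x u) ('d (transition c d) x v);
  form_alternating : forall c x u, charts S c -> cod c x ->
    bilin (form_mx c x) u u = 0;
  form_nondegenerate : forall c x u, charts S c -> cod c x ->
    (forall v, bilin (form_mx c x) u v = 0) -> u = 0;
  form_closed : forall c x (i j k : 'I_n), charts S c -> cod c x ->
    'D_(delta_mx 0 i) (fun y => form_mx c y j k) x +
    'D_(delta_mx 0 j) (fun y => form_mx c y k i) x +
    'D_(delta_mx 0 k) (fun y => form_mx c y i j) x = 0
}.

Section SymplecticManifold.
Variables (R : realType) (n : nat) (M : topologicalType).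
Variable S : smooth_manifold R n M.

Definition smooth_fun (F : M -> R) : Prop :=
  forall c, charts S c -> smooth_on (cod c) (F \o of_vec c).

Definition Cc_infty : set (M -> R) :=
  [set F | smooth_fun F /\ compact (closure [set p | F p != 0])].

Definition sup_norm (F : M -> R) : \bar R :=
  ereal_sup [set `|F p|%:E | p in [set: M]].

Definition chart_at (p : M) : chart R n M :=
  projT1 (cid2 (charts_cover S p)).

Lemma charts_chart_at p : charts S (chart_at p).
Proof. by rewrite /chart_at; case: cid2. Qed.

Lemma dom_chart_at p : dom (chart_at p) p.
Proof. by rewrite /chart_at; case: cid2. Qed.

Variable om : symplectic_form S.

(* The coordinates in the chart c, at the point [x] of [cod c], of sgrad F: the
   vector X such that omega(X, v) = - dF(v) for all v. *)
Definition sgrad (c : chart R n M) (F : M -> R) (x : 'rV[R]_n) : 'rV[R]_n :=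
  xget 0 [set X | forall v,
    bilin (form_mx om c x) X v = - 'd (F \o of_vec c) x v].

Definition poisson_in (c : chart R n M) (F G : M -> R) (p : M) : R :=
  bilin (form_mx om c (to_vec c p))
    (sgrad c G (to_vec c p)) (sgrad c F (to_vec c p)).

(* Independent of the choice of the chart around p: see [poissonE]. *)
Definition poisson (F G : M -> R) (p : M) : R := poisson_in (chart_at p) F G p.

Lemma form_mx_unit c x : charts S c -> cod c x -> form_mx om c x \in unitmx.
Proof.
move=> cS cx; rewrite -row_free_unit -kermx_eq0; apply/eqP/row_matrixP => i.
rewrite row0; apply: (form_nondegenerate (s := om) cS cx) => v.
by rewrite /bilin -row_mul mulmx_ker row0 mul0mx mxE.
Qed.

Lemma bilin_delta (A : 'M[R]_n) i j :
  bilin A (delta_mx 0 i) (delta_mx 0 j) = A i j.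
Proof. by rewrite /bilin trmx_delta -rowE -colE !mxE. Qed.

Lemma bilin_inj (A : 'M[R]_n) (u v : 'rV[R]_n) : A \in unitmx ->
  (forall w, bilin A u w = bilin A v w) -> u = v.
Proof.
move=> Au uv; rewrite -[u](mulmxK Au) -[v](mulmxK Au); congr (_ *m _).
apply/rowP => i; have := uv (delta_mx 0 i).
by rewrite /bilin trmx_delta -!colE !mxE.
Qed.

Lemma sgradP c (F : M -> R) x : charts S c -> cod c x ->
  forall v, bilin (form_mx om c x) (sgrad c F x) v =
    - 'd (F \o of_vec c) x v.
Proof.
move=> cS cx; have Au := form_mx_unit cS cx; rewrite /sgrad.
set P := (X in xget _ X); suff : P (xget 0 P) by [].
apply: (@xgetPex _ 0 P).
exists (- (\row_j 'd (F \o of_vec c) x (delta_mx 0 j)) *m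
        invmx (form_mx om c x)) => v.
rewrite /bilin mulmxKV// mulNmx mxE; congr (- _).
rewrite [in RHS](row_sum_delta v) linear_sum /= mxE; apply: eq_bigr => j _.
by rewrite !mxE linearZ /= mulrC.
Qed.

Lemma smooth_fun_differentiable (F : M -> R) c x : smooth_fun F ->
  charts S c -> cod c x -> differentiable (F \o of_vec c) x.
Proof. by move=> Fs cS cx; have [+ _] := Fs _ cS 1%N; apply. Qed.

Lemma transition_differentiable c d x : charts S c -> charts S d ->
  overlap c d x -> differentiable (transition c d) x.
Proof. by move=> cS dS; have [+ _] := charts_compatible cS dS 1%N; apply. Qed.

Lemma sgrad_transition (F : M -> R) c d x : smooth_fun F ->
  charts S c -> charts S d -> overlap c d x ->
  'd (transition c d) x (sgrad c F x) = sgrad d F (transition c d x).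
Proof.
move=> Fs cS dS cdx; have [cx dx] := cdx.
have dy : cod d (transition c d x) by apply: to_vec_cod.
have tdiff := transition_differentiable cS dS cdx.
have Fc := smooth_fun_differentiable Fs cS cx.
have Fd := smooth_fun_differentiable Fs dS dy.
have chain v : 'd (F \o of_vec c) x v =
    'd (F \o of_vec d) (transition c d x) ('d (transition c d) x v).
  have E : 'd ((F \o of_vec d) \o transition c d) x v =
      'd (F \o of_vec d) (transition c d x) ('d (transition c d) x v).
    exact: (congr1 (fun f : 'rV[R]_n -> R => f v) (diff_comp tdiff Fd)).
  apply: etrans E.
  have Fcd : differentiable ((F \o of_vec d) \o transition c d) x.
    exact: differentiable_comp tdiff Fd.
  apply: etrans (esym (deriveE v Fc)) _; apply: etrans _ (deriveE v Fcd).
  apply: near_eq_derive.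
  have : \forall z \near x, dom d (of_vec c z).
    by apply: (of_vec_continuous cx); apply: open_nbhs_nbhs; split;
      [exact: dom_open|].
  by apply: filterS => z dz /=; rewrite to_vecK.
pose J := lin1_mx ('d (transition c d) x).
have JE v : 'd (transition c d) x v = v *m J by rewrite mul_rV_lin1.
have Ju : J \in unitmx.
  have := form_mx_unit cS cx; rewrite !unitmxE !unitfE.
  suff -> : form_mx om c x = J *m form_mx om d (transition c d x) *m J^T.
    by rewrite !det_mulmx !mulf_eq0 !negb_or => /andP[/andP[]].
  apply/matrixP => i j; rewrite -!bilin_delta.
  rewrite (form_pullback om _ _ cS dS cdx) !JE.
  by rewrite /bilin trmx_mul !mulmxA.
apply: (bilin_inj (form_mx_unit dS dy)) => w.
have [v ->] : exists v, w = 'd (transition c d) x v.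
  by exists (w *m invmx J); rewrite JE mulmxKV.
rewrite -(form_pullback om _ _ cS dS cdx) (sgradP F cS cx) (sgradP F dS dy).
by congr (- _); exact: chain.
Qed.

Lemma poissonE (F G : M -> R) c p : smooth_fun F -> smooth_fun G ->
  charts S c -> dom c p -> poisson F G p = poisson_in c F G p.
Proof.
move=> Fs Gs cS cp; rewrite /poisson /poisson_in; set d := chart_at p.
have dS := charts_chart_at p; have dp := dom_chart_at p.
have dcx : overlap d c (to_vec d p).
  by split; [exact: to_vec_cod | rewrite /preimage /= to_vecK].
rewrite (form_pullback om _ _ dS cS dcx).
rewrite (sgrad_transition Fs dS cS dcx) (sgrad_transition Gs dS cS dcx).
by have -> : transition d c (to_vec d p) = to_vec c p
  by rewrite /transition /= to_vecK.
Qed.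

Definition F3 (X Y Z : set M) : set ((M -> R) * (M -> R)) :=
  [set FG | [/\ Cc_infty FG.1, Cc_infty FG.2,
    (forall p, X p -> FG.1 p <= 0),
    (forall p, Y p -> FG.2 p <= 0) &
    (forall p, Z p -> FG.1 p + FG.2 p >= 1)]].

Definition F4 (X0 X1 Y0 Y1 : set M) : set ((M -> R) * (M -> R)) :=
  [set FG | [/\ Cc_infty FG.1, Cc_infty FG.2,
    (forall p, X0 p -> FG.1 p <= 0) /\ (forall p, X1 p -> FG.1 p >= 1),
    (forall p, Y0 p -> FG.2 p <= 0) &
    (forall p, Y1 p -> FG.2 p >= 1)]].

Definition F3' (X Y Z : set M) : set ((M -> R) * (M -> R)) :=
  [set FG | [/\ Cc_infty FG.1, Cc_infty FG.2,
    (forall p, [/\ FG.1 p >= 0, FG.2 p >= 0 & FG.1 p + FG.2 p <= 1]),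
    set_nbhs X [set p | FG.1 p = 0] /\
    set_nbhs Y [set p | FG.2 p = 0] &
    set_nbhs Z [set p | FG.1 p + FG.2 p = 1]]].

Definition F4' (X0 X1 Y0 Y1 : set M) : set ((M -> R) * (M -> R)) :=
  [set FG | [/\ Cc_infty FG.1, Cc_infty FG.2,
    (forall p, 0 <= FG.1 p <= 1 /\ 0 <= FG.2 p <= 1),
    set_nbhs X0 [set p | FG.1 p = 0] /\
    set_nbhs X1 [set p | FG.1 p = 1] &
    set_nbhs Y0 [set p | FG.2 p = 0] /\
    set_nbhs Y1 [set p | FG.2 p = 1]]].

Definition inf_poisson (A : set ((M -> R) * (M -> R))) : \bar R :=
  ereal_inf [set sup_norm (poisson FG.1 FG.2) | FG in A].

Definition pb3 (X Y Z : set M) : \bar R := inf_poisson (F3 X Y Z).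

Definition pb4 (X0 X1 Y0 Y1 : set M) : \bar R :=
  inf_poisson (F4 X0 X1 Y0 Y1).

End SymplecticManifold.

(* Main.v *)
Require Import Defs.
From HB Require Import structures.
From mathcomp Require Import all_boot all_order all_algebra.
From mathcomp Require Import all_classical all_reals all_analysis.
From mathcomp Require Import ring lra.


(* Let u : R -> R be smooth, equal to 0 near ]-oo, 0] and to 1 near [1, +oo[, with
   0 <= u' <= 1 + t.  For pb_4, replace (F, G) by (u(F), u(G)), which multiplies the bracket by
   u'(F) u'(G).  For pb_3, replace it by (u(F), (1 - u(F)) u(G / (1 - F))), which multiplies the
   bracket by u'(F) (1 - u(F)) / (1 - F) u'(G / (1 - F)); here 1 - u(F) <= (1 + t) (1 - F) for
   F < 1, because u(1) = 1.  In both cases the new pair belongs to the smaller class and its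
   bracket is at most (1 + t)^3 times the old one; then let t tend to 0. *)

Set Implicit Arguments.
Unset Strict Implicit.
Unset Printing Implicit Defensive.

Import Order.TTheory GRing.Theory Num.Theory.
Import numFieldNormedType.Exports.

Local Open Scope classical_set_scope.
Local Open Scope ring_scope.

(** * Calculus of maps of class C^k on an open set *)

Section CkCalculus.
Variables (R : realType) (V : normedModType R).
Implicit Types (U : set V) (k : nat).

Lemma near_eq_differentiable (W : normedModType R) (f g : V -> W) (x : V) :
  {near x, f =1 g} -> differentiable f x -> differentiable g x.
Proof.
move=> fg /diff_locallyP[dfc /eqaddoP dxf].
have fgx : f x = g x := nbhs_singleton fg.
have gE : g \o shift x = cst (g x) + 'd f x +o_ 0 id.
  apply/eqaddoP => e e0; have := dxf _ e0.
  have : \forall h \near 0, f (h + x) = g (h + x).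
    have := fg : \forall y \near x, f y = g y.
    by rewrite (near_shift 0) /= subr0.
  by apply: filterS2 => h fgh; rewrite -fgx !fctE /= fgh.
by apply/diff_locallyP; rewrite (diff_unique dfc gE).
Qed.

(** As U is open, the maps agree near each of its points, hence so do their derivatives. This lets
    the rules below replace a derivative by a formula valid on U only. *)
Lemma Ck_on_eq (W : normedModType R) k U (f g : V -> W) : open U ->
  (forall x, U x -> f x = g x) -> Ck_on k U f -> Ck_on k U g.
Proof.
move=> Uo; elim: k f g => [|k IHk] f g fg /=.
  move=> fc x Ux; suff : g y @[y --> x] --> g x by [].
  rewrite -(fg x Ux).
  apply: cvg_trans (fc x Ux); apply: near_eq_cvg.
  by apply: filterS (open_nbhs_nbhs (conj Uo Ux)) => y /fg.
move=> [fd fk]; have near_fg x : U x -> {near x, f =1 g}.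
  by move=> Ux; apply: filterS (open_nbhs_nbhs (conj Uo Ux)) => y /fg.
split=> [x Ux|v]; first exact: near_eq_differentiable (near_fg x Ux) (fd x Ux).
by apply: IHk (fk v) => x Ux; apply/near_eq_derive/near_fg.
Qed.

Lemma Ck_onW (W : normedModType R) k U (f : V -> W) :
  Ck_on k.+1 U f -> Ck_on k U f.
Proof.
elim: k f => [|k IHk] f [fd fk]; first by move=> x /fd/differentiable_continuous.
by split=> // v; apply: IHk.
Qed.

Lemma Ck_on_sub (W : normedModType R) k U U' (f : V -> W) :
  U' `<=` U -> Ck_on k U f -> Ck_on k U' f.
Proof.
move=> UU'; elim: k f => [|k IHk] f /=; first by move=> fU x /UU'; apply: fU.
by move=> [fd fk]; split=> [x /UU'|v]; [apply: fd | apply: IHk].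
Qed.

(** [Ck_on] constrains a total map point by point, so its conditions on two sets add up. This glues
    regions where a function has different formulas. *)
Lemma Ck_on_setU (W : normedModType R) k U U' (f : V -> W) :
  Ck_on k U f -> Ck_on k U' f -> Ck_on k (U `|` U') f.
Proof.
elim: k f => [|k IHk] f /=; first by move=> fU fU' x [/fU|/fU'].
by move=> [fd fk] [fd' fk']; split=> [x [/fd|/fd']//|v]; apply: IHk.
Qed.

Lemma Ck_on_cst (W : normedModType R) k U (a : W) : Ck_on k U (cst a : V -> W).
Proof.
elim: k a => [|k IHk] a /=; first by move=> x _; exact: cst_continuous.
split=> // v; rewrite (_ : (fun _ => _) = cst 0) //.
by apply/funext => x; rewrite derive_cst.
Qed.

Lemma Ck_onD (W : normedModType R) k U (f g : V -> W) : open U ->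
  Ck_on k U f -> Ck_on k U g -> Ck_on k U (f \+ g).
Proof.
move=> Uo; elim: k f g => [|k IHk] f g /=.
  by move=> fc gc x Ux; apply: continuousD; [apply: fc|apply: gc].
move=> [fd fk] [gd gk]; split=> [x Ux|v].
  by apply: differentiableD; [apply: fd|apply: gd].
apply: Ck_on_eq (IHk _ _ (fk v) (gk v)) => // x Ux /=.
by rewrite deriveD //; apply: diff_derivable; [apply: fd|apply: gd].
Qed.

(** The derivative is f Dg + g Df, so the induction also needs f and g themselves one order
    lower. *)
Lemma Ck_onM k U (f g : V -> R) : open U ->
  Ck_on k U f -> Ck_on k U g -> Ck_on k U (f \* g).
Proof.
move=> Uo; elim: k f g => [|k IHk] f g.
  by move=> fc gc x Ux; apply: continuousM; [apply: fc|apply: gc].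
move=> fk1 gk1; have [fk0 gk0] := (Ck_onW fk1, Ck_onW gk1).
move: fk1 gk1 => [fd fk] [gd gk]; split=> [x Ux|v].
  by apply: differentiableM; [apply: fd|apply: gd].
apply: Ck_on_eq (Ck_onD Uo (IHk _ _ fk0 (gk v)) (IHk _ _ gk0 (fk v))) => // x Ux /=.
by rewrite deriveM //; apply: diff_derivable; [apply: fd|apply: gd].
Qed.

(** Induction through D(1/f) = -(1/f)^2 Df, with 1/f on the right one order lower. *)
Lemma Ck_onV k U (f : V -> R) : open U -> (forall x, U x -> f x != 0) ->
  Ck_on k U f -> Ck_on k U (fun x => (f x)^-1).
Proof.
move=> Uo f0; elim: k => [|k IHk].
  by move=> fc x Ux; apply: continuousV; [apply: f0|apply: fc].
move=> fk1; have Vk := IHk (Ck_onW fk1); move: fk1 => [fd fk].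
split=> [x Ux|v]; first by apply: differentiableV; [apply: fd|apply: f0].
have NVk := Ck_onM Uo (@Ck_on_cst R k U (- 1)) (Ck_onM Uo Vk Vk).
apply: Ck_on_eq (Ck_onM Uo NVk (fk v)) => // x Ux /=.
rewrite deriveV ?f0 //; last exact/diff_derivable/fd.
by rewrite mulN1r -expr2 exprVn.
Qed.

Lemma differentiable_onem (f : V -> R) (x : V) :
  differentiable f x -> differentiable (fun y => 1 - f y) x.
Proof. exact: differentiableB (differentiable_cst (1 : R) x). Qed.

Lemma derive_onem (f : V -> R) (x v : V) : differentiable f x ->
  'D_v (fun y => 1 - f y) x = - 'D_v f x.
Proof.
move=> fd; have fv := @diff_derivable _ _ _ f x v fd.
have -> : (fun y => 1 - f y) = cst (1 : R) - f by [].
by rewrite deriveB ?derive_cst ?sub0r //; exact: derivable_cst.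
Qed.

Lemma derive_comp (f : V -> R) (u : R -> R) (x v : V) :
  differentiable f x -> differentiable u (f x) ->
  'D_v (u \o f) x = 'D_1 u (f x) * 'D_v f x.
Proof.
move=> fd ud; rewrite deriveE; last exact: differentiable_comp.
rewrite diff_comp //= !deriveE // -[X in 'd u _ X]mulr1 [LHS]linearZ.
by rewrite mulrC.
Qed.

(** Induction through D(u o f) = (u' o f) Df; u must vary, since u' takes its place. *)
Lemma Ck_on_comp k U (f : V -> R) (u : R -> R) : open U ->
  Ck_on k [set: R] u -> Ck_on k U f -> Ck_on k U (u \o f).
Proof.
move=> Uo; elim: k f u => [|k IHk] f u.
  by move=> uc fc x Ux; apply: continuous_comp; [apply: fc|apply: uc].
move=> [ud uk] fk1; have fk0 := Ck_onW fk1; move: fk1 => [fd fk].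
split=> [x Ux|v]; first by apply: differentiable_comp; [apply: fd|apply: ud].
apply: Ck_on_eq (Ck_onM Uo (IHk _ _ (uk 1) fk0) (fk v)) => // x Ux /=.
by rewrite derive_comp //; [apply: fd|apply: ud].
Qed.

End CkCalculus.

Lemma smooth_on_id (R : realType) : smooth_on [set: R] (id : R -> R).
Proof.
case=> [|k] /=; first by move=> x _; exact: cvg_id.
split=> [x _|v]; first exact: ex_diff.
by under eq_fun do rewrite derive_id; exact: Ck_on_cst.
Qed.

(** * Smooth functions that are flat at 0 *)

Section FlatFunctions.
Variable R : realType.

(* Smooth at 0 because the family, indexed by p, is closed under derivation. *)
Definition flat (p : {poly R}) (x : R) : R :=
  if 0 < x then p.[x^-1] * expR (- x^-1) else 0.

(** For x > 0 the derivative of p(1/x) exp(-1/x) is x^(-2) (p - p')(1/x) exp(-1/x), and ['X^2] at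
    1/x supplies x^(-2). *)
Definition flat_deriv (p : {poly R}) : {poly R} := 'X^2 * (p - p^`()).

Lemma expr_le_expR (n : nat) (t : R) : 0 <= t -> t ^+ n <= n`!%:R * expR t.
Proof.
move=> t0; case: n => [|n]; first by rewrite expr0 mul1r -expR0 ler_expR.
rewrite mulrC -ler_pdivrMr ?ltr0n ?fact_gt0 //.
by apply: le_trans (expR_ge1Dxn n t0); rewrite lerDr.
Qed.

Lemma horner_le_expR (p : {poly R}) :
  exists2 C : R, 0 <= C & forall t, 0 <= t -> `|p.[t]| <= C * expR t.
Proof.
exists (\sum_(i < size p) `|p`_i| * i`!%:R) => [|t t0].
  by apply: sumr_ge0 => i _; rewrite mulr_ge0.
rewrite horner_coef mulr_suml; apply: le_trans (ler_norm_sum _ _ _) _.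
apply: ler_sum => i _; rewrite normrM -mulrA ler_wpM2l //.
by rewrite normrX ger0_norm // expr_le_expR.
Qed.

(** Bounding X^2 p, instead of p, by the exponential at 1/x gains the factor x^2. This is what
    yields the derivative at 0. *)
Lemma flat_le_sqr (p : {poly R}) :
  exists2 C : R, 0 <= C & forall x, `|flat p x| <= C * x ^+ 2.
Proof.
have [C C0 pC] := horner_le_expR ('X^2 * p); exists C => // x.
rewrite /flat; case: ifPn => [x0|_]; last by rewrite normr0 mulr_ge0 // sqr_ge0.
have xV0 : 0 <= x^-1 by rewrite invr_ge0 ltW.
have := pC _ xV0; rewrite hornerM hornerXn normrM.
rewrite ger0_norm ?exprn_ge0 // exprVn mulrC ler_pdivrMr ?exprn_gt0 // => pxC.
rewrite normrM (ger0_norm (expR_ge0 _)).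
rewrite expRN ler_pdivrMr ?expR_gt0 //; apply: le_trans pxC _.
by rewrite mulrAC.
Qed.

(** The difference quotient at 0 is at most C |h| in absolute value. *)
Lemma is_derive_sqr_bounded (f : R -> R) (C : R) : 0 <= C ->
  (forall x, `|f x| <= C * x ^+ 2) -> is_derive (0 : R) 1 f 0.
Proof.
move=> C0 fC; have f0 : f 0 = 0.
  by apply/normr0_eq0/le_anti; rewrite normr_ge0 (le_trans (fC 0)) ?expr0n ?mulr0.
have cvg0 : h^-1 *: (f (h *: 1 + 0) - f 0) @[h --> (0 : R)^'] --> (0 : R).
  apply/cvgr0Pnorm_le => e e0; near=> h.
  have h0 : h != 0 by near: h; exact: nbhs_dnbhs_neq.
  rewrite f0 subr0 addr0 [h *: 1]mulr1 normrZ normfV mulrC.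
  rewrite ler_pdivrMr ?normr_gt0 //; apply: le_trans (fC h) _.
  rewrite -real_normK ?num_real // expr2 mulrA ler_wpM2r //.
  (* Dividing by C + 1 covers the case C = 0. *)
  have hC : `|h| <= e / (C + 1).
    near: h; apply: dnbhs0_le; rewrite divr_gt0 //.
    by rewrite ltr_wpDl.
  apply: (@le_trans _ _ ((C + 1) * `|h|)); first by rewrite ler_wpM2r // lerDl.
  by rewrite mulrC -ler_pdivlMr // ltr_wpDl.
by apply: DeriveDef; [apply/cvg_ex; exists 0 | apply/cvg_lim].
Unshelve. all: by end_near. Qed.

Lemma is_derive_flat (p : {poly R}) (x : R) :
  is_derive x 1 (flat p) (flat (flat_deriv p) x).
Proof.
have [x0|x0|->] := ltgtP x 0.
- rewrite {2}/flat ltNge (ltW x0) /=.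
  apply: (@near_eq_is_derive R R R (cst 0)).
  by near=> y; rewrite /flat ltNge ltW //; near: y; apply: lt_nbhsl.
- apply: (@near_eq_is_derive R R R (fun y => p.[y^-1] * expR (- y^-1))).
    by near=> y; rewrite /flat ifT //; near: y; apply: lt_nbhsr.
  have xn0 : x != 0 by rewrite gt_eqF.
  have dV : is_derive x 1 (fun y : R => y^-1) (- x ^- 2).
    apply: DeriveDef; first exact: derivableV.
    by rewrite deriveV // derive_id [_ *: _]mulr1.
  have dp : is_derive x 1 (fun y => p.[y^-1]) (p^`().[x^-1] * - x ^- 2).
    apply: (@is_derive1_comp _ (horner p) (fun y => y^-1)).
  have de : is_derive x 1 (fun y => expR (- y^-1)) (expR (- x^-1) * x ^- 2).
    apply: (@is_derive1_comp _ expR (fun y => - y^-1)).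
    by apply: is_derive_eq; rewrite opprK.
  apply: is_derive_eq; rewrite /flat x0 /flat_deriv.
  rewrite hornerM hornerXn hornerD hornerN exprVn.
  by rewrite /GRing.scale /=; ring.
- have [C C0 pC] := flat_le_sqr p.
  by rewrite {2}/flat ltxx; apply: is_derive_sqr_bounded pC.
Unshelve. all: by end_near. Qed.

Lemma differentiable_flat (p : {poly R}) (x : R) : differentiable (flat p) x.
Proof. by apply/derivable1_diffP; have [] := is_derive_flat p x. Qed.

Lemma smooth_flat (p : {poly R}) : smooth_on [set: R] (flat p).
Proof.
move=> k; elim: k p => [|k IHk] p.
  by move=> x _; exact/differentiable_continuous/differentiable_flat.
split=> [x _|v]; first exact: differentiable_flat.
(* The direction v is a scalar, so the derivative along v is v times the ordinary one. *)
rewrite (_ : (fun _ => _) = cst v \* flat (flat_deriv p)).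
  by apply: Ck_onM; [exact: openT | exact: Ck_on_cst | exact: IHk].
apply/funext => x; have dfl := differentiable_flat p x.
by rewrite deriveE // diff1E // derive1E; have [_ ->] := is_derive_flat p x.
Qed.

End FlatFunctions.

(** * Cutoff functions with slope close to 1 *)

Section Cutoff.
Variable R : realType.

Lemma derive_bounds_incr (f f' : R -> R) (c x y : R) :
  (forall z : R, is_derive z 1 f (f' z)) -> (forall z, 0 <= f' z <= c) ->
  x <= y -> 0 <= f y - f x <= c * (y - x).
Proof.
move=> fE f'c xy.
have fc : {within `[x, y], continuous f}.
  apply: continuous_subspaceT => z; apply: differentiable_continuous.
  by apply/derivable1_diffP; have [] := fE z.
have [z _ ->] := MVT_segment xy (fun z _ => fE z) fc.
have /andP[f0 fz] := f'c z; have d0 : 0 <= y - x by rewrite subr_ge0.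
by rewrite mulr_ge0 //= ler_wpM2r.
Qed.

(* The ramp is x exp(-e/x) for positive x; its derivative (1 + t) exp(-t), with t = e/x, is
   at most 1. *)
Lemma exists_smooth_ramp (e : R) : 0 < e ->
  exists h h' : R -> R, [/\ smooth_on [set: R] h,
    (forall x : R, is_derive x 1 h (h' x)), (forall x, 0 <= h' x <= 1),
    (forall x, x <= 0 -> h x = 0) & 1 - e <= h 1].
Proof.
move=> e0; pose s (x : R) := e^-1 * x.
have s_gt0 x : (0 < s x) = (0 < x) by rewrite /s pmulr_rgt0 ?invr_gt0.
have sD (x : R) : is_derive x 1 s e^-1.
  by apply: is_derive_eq; rewrite [_ *: _]mulr1.
exists (fun x => x * flat 1 (s x)).
exists (fun x => x * (flat (flat_deriv 1) (s x) * e^-1) + flat 1 (s x)); split.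
- move=> k; apply: Ck_onM; [exact: openT|exact: smooth_on_id|].
  apply: (Ck_on_comp openT (@smooth_flat R 1 k)).
  by apply: Ck_onM; [exact: openT|exact: Ck_on_cst|exact: smooth_on_id].
- move=> x; have fD := is_derive_flat (1 : {poly R}) (s x).
  have fsD := @is_derive1_comp _ (flat 1) s x _ _ fD (sD x).
  apply: (is_derive_eq (is_deriveM (is_derive_id x 1) fsD)).
  by rewrite [flat 1 (s x) *: _]mulr1.
- move=> x; rewrite /flat s_gt0; case: ifPn => [x0|_]; last first.
    by rewrite mul0r mulr0 addr0 lexx ler01.
  rewrite /flat_deriv derivC subr0 mulr1 hornerXn hornerC mul1r.
  (* With t = e/x, which is [(s x)^-1], the first summand of the derivative is t exp(-t). *)
  have tE : x * ((s x)^-1 ^+ 2 * expR (- (s x)^-1) * e^-1) =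
      (s x)^-1 * expR (- (s x)^-1).
    rewrite /s; field; by rewrite !gt_eqF.
  rewrite tE -[X in _ + X]mul1r -mulrDl.
  have t0 : 0 <= (s x)^-1 by rewrite invr_ge0 ltW ?s_gt0.
  rewrite mulr_ge0 ?expR_ge0 ?addr_ge0 //= expRN ler_pdivrMr ?expR_gt0 //.
  by rewrite mul1r addrC expR_ge1Dx.
- by move=> x x0; rewrite /flat s_gt0 ltNge x0 /= mulr0.
(* The value at 1 is exp(-e). *)
- rewrite /flat s_gt0 ltr01 hornerC !mul1r /s mulr1 invrK.
  by apply: le_trans (expR_ge1Dx _).
Qed.

(** A margin d > 0 turns a weak inequality such as F <= 0 at a point into the equality u(F) = 0 near
    it. *)
Definition cutoff (c d : R) (u u' : R -> R) : Prop :=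
  [/\ smooth_on [set: R] u, (forall x : R, is_derive x 1 u (u' x)),
      (forall x, 0 <= u' x <= c), (forall x, x <= d -> u x = 0) &
      (forall x, 1 - d <= x -> u x = 1)].

(* With a ramp h and H := h / h(1), the function y |-> 1 - H (1 - H y) vanishes for y <= 0
   and equals 1 for y >= 1; an affine reparametrization widens both plateaus. *)
Lemma exists_cutoff (t : R) : 0 < t <= 1 ->
  exists d u u', 0 < d /\ cutoff (1 + t) d u u'.
Proof.
(* The final slope is at most 1 / ((1 - e)^2 (1 - 2e)); for e <= 1/20 this is at most 1 + 20e = 1 +
   t. *)
move=> /andP[t0 t1]; pose e := t / 20; have e0 : 0 < e by rewrite /e; lra.
have e1 : e <= 20^-1 by rewrite /e; lra.
have [h [h' [hs hD h'01 h0 h1e]]] := exists_smooth_ramp e0.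
have h1 : 0 < h 1 by apply: lt_le_trans h1e; lra.
have h_ge1 x : 1 <= x -> h 1 <= h x.
  by move=> /(derive_bounds_incr hD h'01); rewrite subr_ge0 => /andP[].
(* [A] carries [e, 1 - e] onto [0, 1], which makes room for plateaus of margin e. *)
pose a := (1 - 2 * e)^-1; have a0 : 0 < a by rewrite invr_gt0; lra.
pose A x := a * (x - e); pose H x := (h 1)^-1 * h x; pose K x := 1 + - 1 * H x.
have AD (x : R) : is_derive x 1 A a.
  apply: is_derive_eq; rewrite /= subr0 [_ *: _]mulr1; reflexivity.
have HD (x : R) : is_derive x 1 H ((h 1)^-1 * h' x).
  exact: (is_deriveZ (h 1)^-1 (hD x)).
have KD (x : R) : is_derive x 1 K (- 1 * ((h 1)^-1 * h' x)).
  have := is_deriveD (is_derive_cst (1 : R) x 1) (is_deriveZ (- 1) (HD x)).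
  by rewrite add0r.
exists e, (K \o (K \o A)).
exists (fun x => - 1 * ((h 1)^-1 * h' (K (A x))) *
               (- 1 * ((h 1)^-1 * h' (A x)) * a)).
split=> //; split.
- move=> k; have Ko := openT : open [set: R].
  have Kk : Ck_on k [set: R] K.
    apply: Ck_onD => //; first exact: Ck_on_cst.
    apply: Ck_onM => //; first exact: Ck_on_cst.
    by apply: Ck_onM => //; exact: Ck_on_cst.
  apply: Ck_on_comp => //; apply: Ck_on_comp => //.
  apply: Ck_onM => //; first exact: Ck_on_cst.
  by apply: Ck_onD => //; [exact: smooth_on_id|exact: Ck_on_cst].
- by move=> x; apply: is_derive1_comp.
- move=> x; have /andP[p0 p1] := h'01 (K (A x)); have /andP[q0 q1] := h'01 (A x).
  (* The signs of the two reflections cancel. *)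
  rewrite (_ : _ * _ = h' (K (A x)) * h' (A x) * ((h 1)^-1 ^+ 2 * a)); last by ring.
  have c0 : 0 <= (h 1)^-1 ^+ 2 * a
    by apply: mulr_ge0; [apply: exprn_ge0; rewrite invr_ge0|]; apply: ltW.
  rewrite (mulr_ge0 (mulr_ge0 p0 q0) c0) /=; apply: (@le_trans _ _ ((h 1)^-1 ^+ 2 * a)).
    by rewrite ler_piMl // mulr_ile1.
  rewrite /a exprVn -invfM -[leLHS]mul1r ler_pdivrMr; last first.
    by rewrite mulr_gt0 ?exprn_gt0 //; lra.
  apply: (@le_trans _ _ ((1 + 20 * e) * ((1 - e) ^+ 2 * (1 - 2 * e)))).
    by rewrite /e in e0 e1 *; nra.
  have -> : 20 * e = t by rewrite /e; field.
  rewrite ler_wpM2l ?ler_wpM2r //; [by lra|by lra|].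
  by rewrite ler_pXn2r ?nnegrE //; lra.
(* The inner [K] is 1 here, and the outer one is 1 - h(1)/h(1) = 0. *)
- move=> x xe; have Ax0 : A x <= 0 by rewrite pmulr_rle0 // subr_le0.
  rewrite /= /K /H (h0 _ Ax0) !mulr0 addr0.
  by rewrite mulVf ?gt_eqF // mulN1r subrr.
(* As h is nondecreasing, the inner [K] is at most 0, where the outer one equals 1. *)
- move=> x xe; have Ax1 : 1 <= A x.
    by rewrite /A /a mulrC ler_pdivlMr; lra.
  have K0 : K (A x) <= 0.
    rewrite /K /H mulN1r subr_le0 mulrC ler_pdivlMr // mul1r.
    exact: h_ge1.
  by rewrite /= {1}/K /H (h0 _ K0) !mulr0 addr0.
Qed.

(** Between the plateaus the nondecreasing u is compared with its values 0 at [d] and 1 at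
    [1 - d]. *)
Lemma cutoff01 (c d : R) (u u' : R -> R) : cutoff c d u u' ->
  forall x, 0 <= u x <= 1.
Proof.
move=> [_ uD u'c u0 u1] x; apply/andP; split.
  have [/u0 -> //|/ltW dx] := leP x d.
  have /andP[+ _] := derive_bounds_incr uD u'c dx.
  by rewrite (u0 d) // subr0.
have [/u1 -> //|/ltW xd] := leP (1 - d) x.
have /andP[+ _] := derive_bounds_incr uD u'c xd.
by rewrite (u1 (1 - d)) // subr_ge0.
Qed.

End Cutoff.

(** * Alternating bilinear forms on pairs of combinations *)

Section Bilin.
Variables (R : realType) (n : nat) (A : 'M[R]_n).
Implicit Types u v w : 'rV[R]_n.

Lemma bilin_lincombl (a b : R) u v w :
  bilin A (a *: u + b *: v) w = a * bilin A u w + b * bilin A v w.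
Proof. by rewrite /bilin !mulmxDl -!scalemxAl !mxE. Qed.

Lemma bilin_lincombr (a b : R) u v w :
  bilin A w (a *: u + b *: v) = a * bilin A w u + b * bilin A w v.
Proof. by rewrite /bilin linearD !linearZ /= mulmxDr -!scalemxAr !mxE. Qed.

(** Only the mixed terms survive, and they are opposite. The order of the vectors is that of the
    bracket, where sgrad G precedes sgrad F. *)
Lemma bilin_alternating_det (a b a' b' : R) u v : (forall w, bilin A w w = 0) ->
  bilin A (a' *: u + b' *: v) (a *: u + b *: v) = (a * b' - a' * b) * bilin A v u.
Proof.
move=> alt; have uv : bilin A u v = - bilin A v u.
  have := alt (1 *: u + 1 *: v); rewrite bilin_lincombl !bilin_lincombr !alt.
  by rewrite !mul1r add0r addr0 => /eqP; rewrite addr_eq0 => /eqP.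
by rewrite bilin_lincombl !bilin_lincombr !alt uv; ring.
Qed.

End Bilin.

(** * Effect of a change of functions on the Poisson bracket *)

Section Rearrangement.
Variables (R : realType) (n : nat) (M : topologicalType).
Variables (S : smooth_manifold R n M) (om : symplectic_form S).
Implicit Types (F G : M -> R) (c : chart R n M) (p : M).

Lemma smooth_fun_continuous F : smooth_fun S F -> continuous F.
Proof.
move=> Fs p; have cS := charts_chart_at S p; have cp := dom_chart_at S p.
set c := chart_at S p in cS cp.
have Fc : {for p, continuous ((F \o of_vec c) \o to_vec c)}.
  apply: continuous_comp; first exact: to_vec_continuous.
  exact/(Fs c cS 0%N)/to_vec_cod.
suff : F q @[q --> p] --> F p by [].
have -> : F p = ((F \o of_vec c) \o to_vec c) p by rewrite /= to_vecK.
apply: cvg_trans Fc; apply: near_eq_cvg.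
by apply: filterS (open_nbhs_nbhs (conj (dom_open c) cp)) => q /to_vecK /= ->.
Qed.

Lemma compact_support_sub F G : compact (closure [set p | F p != 0]) ->
  (forall p, F p = 0 -> G p = 0) -> compact (closure [set p | G p != 0]).
Proof.
move=> Fc FG; apply: subclosed_compact Fc _; first exact: closed_closure.
by apply: closureS => p /=; apply: contra_neq => /FG.
Qed.

(** By nondegeneracy omega determines sgrad from the differential, and does so linearly. *)
Lemma sgrad_lincomb F G F1 c (x : 'rV[R]_n) (a b : R) : charts S c -> cod c x ->
  (forall v, 'd (F1 \o of_vec c) x v =
     a * 'd (F \o of_vec c) x v + b * 'd (G \o of_vec c) x v) ->
  sgrad om c F1 x = a *: sgrad om c F x + b *: sgrad om c G x.
Proof.
move=> cS cx dF1; apply: (bilin_inj (form_mx_unit om cS cx)) => w.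
rewrite (sgradP om F1 cS cx) dF1.
have := sgradP om G cS cx w; have := sgradP om F cS cx w.
move: (sgrad om c F x) (sgrad om c G x) => X Y EX EY.
by rewrite bilin_lincombl EX EY !mulrN -opprD.
Qed.

(** Both rearranged pairs have differentials combining dF and dG at each point; the bracket then
    picks up the determinant of the coefficients. *)
Lemma poisson_lincomb F G F1 G1 p (a b a' b' : R) :
  (forall v, 'd (F1 \o of_vec (chart_at S p)) (to_vec (chart_at S p) p) v =
     a * 'd (F \o of_vec (chart_at S p)) (to_vec (chart_at S p) p) v +
     b * 'd (G \o of_vec (chart_at S p)) (to_vec (chart_at S p) p) v) ->
  (forall v, 'd (G1 \o of_vec (chart_at S p)) (to_vec (chart_at S p) p) v =
     a' * 'd (F \o of_vec (chart_at S p)) (to_vec (chart_at S p) p) v +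
     b' * 'd (G \o of_vec (chart_at S p)) (to_vec (chart_at S p) p) v) ->
  poisson om F1 G1 p = (a * b' - a' * b) * poisson om F G p.
Proof.
have cS := charts_chart_at S p; have cx := to_vec_cod (dom_chart_at S p).
move=> dF1 dG1; rewrite /poisson /poisson_in.
rewrite (sgrad_lincomb cS cx dF1) (sgrad_lincomb cS cx dG1).
apply: bilin_alternating_det => w.
exact: (form_alternating om w cS cx).
Qed.

Variables (k d : R) (u u' : R -> R).
Hypotheses (d_gt0 : 0 < d) (uP : cutoff k d u u').

Lemma cutoff_ge0 : 0 <= k.
Proof.
by have [_ _ u'k _ _] := uP; have /andP[u'0 u'0k] := u'k 0; exact: le_trans u'0k.
Qed.

Lemma cutoff_differentiable (y : R) : differentiable u y.
Proof. by have [us _ _ _ _] := uP; have [+ _] := us 1%N; apply. Qed.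

Lemma cutoff_derive (y : R) : 'D_1 u y = u' y.
Proof. by have [_ uD _ _ _] := uP; have [_ ->] := uD y. Qed.

Lemma cutoff_smooth_fun F : smooth_fun S F -> smooth_fun S (u \o F).
Proof.
have [us _ _ _ _] := uP; move=> Fs c cS i.
exact: (Ck_on_comp (@cod_open _ _ _ c) (us i) (Fs c cS i)).
Qed.

(** Because d > 0, u vanishes at 0 and the support does not grow. *)
Lemma cutoff_Cc_infty F : Cc_infty S F -> Cc_infty S (u \o F).
Proof.
move=> [Fs Fc]; split; first exact: cutoff_smooth_fun.
apply: compact_support_sub Fc _ => p /= ->.
by have [_ _ _ u0 _] := uP; rewrite u0 // ltW.
Qed.

Lemma diff_cutoff (V : normedModType R) (f : V -> R) (x v : V) : differentiable f x ->
  'd (u \o f) x v = u' (f x) * 'd f x v.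
Proof.
move=> fx; have ux := cutoff_differentiable (f x).
rewrite -deriveE; last exact: differentiable_comp.
by rewrite derive_comp // cutoff_derive deriveE.
Qed.

(** The coefficient matrix is diagonal with entries u'(F) and u'(G), both in [0, k]. *)
Lemma poisson_cutoff F G p : smooth_fun S F -> smooth_fun S G ->
  `|poisson om (u \o F) (u \o G) p| <= k ^+ 2 * `|poisson om F G p|.
Proof.
move=> Fs Gs; set c := chart_at S p; set x := to_vec c p.
have cS : charts S c := charts_chart_at S p.
have cx : cod c x := to_vec_cod (dom_chart_at S p).
rewrite (@poisson_lincomb F G (u \o F) (u \o G) p (u' (F (of_vec c x))) 0
  0 (u' (G (of_vec c x)))).
- rewrite mulr0 subr0 normrM ler_wpM2r //.
  have [_ _ u'k _ _] := uP.
  have /andP[F0 Fk] := u'k (F (of_vec c x)).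
  have /andP[G0 Gk] := u'k (G (of_vec c x)).
  by rewrite normrM !ger0_norm // expr2 ler_pM.
- move=> v; rewrite mul0r addr0.
  exact: (diff_cutoff _ (smooth_fun_differentiable Fs cS cx)).
- move=> v; rewrite mul0r add0r.
  exact: (diff_cutoff _ (smooth_fun_differentiable Gs cS cx)).
Qed.

(* With [u \o F], this maps the plane onto the triangle with vertices (0, 0), (1, 0) and
   (0, 1).  For F >= 1 the first factor vanishes, whatever the value of the quotient. *)
Definition triangle F G p : R := (1 - u (F p)) * u (G p / (1 - F p)).

Lemma triangle_ge F G p : 1 - d <= F p -> triangle F G p = 0.
Proof. by have [_ _ _ _ u1] := uP; rewrite /triangle => /u1 ->; rewrite subrr mul0r. Qed.

Lemma triangle_bounds F G p : 0 <= triangle F G p <= 1 - u (F p).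
Proof.
have /andP[_ F1] := cutoff01 uP (F p).
have /andP[G0 G1] := cutoff01 uP (G p / (1 - F p)).
by rewrite mulr_ge0 ?subr_ge0 //= ler_piMr // subr_ge0.
Qed.

(** In the first case with F < 1 the quotient is below d; otherwise F lies on the upper plateau. The
    division-free form persists near a point by continuity. *)
Lemma triangle_eq0 F G p : G p < d * (1 - F p) \/ 1 - d <= F p -> triangle F G p = 0.
Proof.
have [_ _ _ u0 _] := uP; move=> [GF|]; last exact: triangle_ge.
have [F1|F1] := ltP (F p) 1; last by apply/triangle_ge/(le_trans _ F1); rewrite gerBl ltW.
by rewrite /triangle (u0 (_ / _)) ?mulr0 // ler_pdivrMr ?subr_gt0 // ltW.
Qed.

(** A quotient above 1 - d has cutoff 1, and the sum is u(F) + (1 - u(F)); on the plateau of F it is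
    1 + 0. *)
Lemma triangle_sum F G p : (1 - d) * (1 - F p) < G p \/ 1 - d <= F p ->
  u (F p) + triangle F G p = 1.
Proof.
have [_ _ _ _ u1] := uP; move=> [GF|Fd]; last by rewrite triangle_ge // addr0 u1.
have [F1|F1] := ltP (F p) 1; last first.
  have Fd : 1 - d <= F p by apply: le_trans F1; rewrite gerBl ltW.
  by rewrite triangle_ge // addr0 u1.
rewrite /triangle (u1 (_ / _)) ?mulr1 ?subrKC //.
by rewrite ler_pdivlMr ?subr_gt0 // ltW.
Qed.

Lemma open_preimage_on c (f : 'rV[R]_n -> R) (A : set R) :
  (forall x, cod c x -> {for x, continuous f}) -> open A ->
  open (cod c `&` f @^-1` A).
Proof.
move=> fc Ao; rewrite openE => x [cx Ax]; apply: filterI.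
  exact: open_nbhs_nbhs (conj (@cod_open _ _ _ c) cx).
by apply: (fc x cx); exact: open_nbhs_nbhs (conj Ao Ax).
Qed.

(** Two open sets cover the chart: F < 1, where the quotient is smooth, and F > 1 - d, where the
    function vanishes. They cover because d > 0. *)
Lemma triangle_smooth_fun F G : smooth_fun S F -> smooth_fun S G ->
  smooth_fun S (triangle F G).
Proof.
have [us _ _ _ _] := uP; move=> Fs Gs c cS i.
set f := F \o of_vec c; set g := G \o of_vec c.
pose U1 := cod c `&` f @^-1` [set y | y < 1].
pose U2 := cod c `&` f @^-1` [set y | 1 - d < y].
have fc x : cod c x -> {for x, continuous f} by apply: (Fs c cS 0%N).
have U1o : open U1 by apply: open_preimage_on => //; exact: open_lt.
have U2o : open U2 by apply: open_preimage_on => //; exact: open_gt.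
have fk : Ck_on i U1 f by apply: Ck_on_sub (Fs c cS i) => x [].
have gk : Ck_on i U1 g by apply: Ck_on_sub (Gs c cS i) => x [].
have onem (h : 'rV[R]_n -> R) : Ck_on i U1 h -> Ck_on i U1 (fun x => 1 - h x).
  move=> hk; have := Ck_onD U1o (@Ck_on_cst R _ R i U1 1)
    (Ck_onM U1o (@Ck_on_cst R _ R i U1 (- 1)) hk).
  by apply: Ck_on_eq => // x _ /=; rewrite mulN1r.
apply: (@Ck_on_sub _ _ _ _ (U1 `|` U2)) => [x cx|].
  have [f1|f1] := ltP (f x) 1; [by left|right].
  by split=> //=; apply: lt_le_trans f1; rewrite gtrBl.
apply: Ck_on_setU.
- apply: Ck_onM => //; first exact/onem/Ck_on_comp.
  apply: Ck_on_comp => //; apply: Ck_onM => //; apply: Ck_onV => //.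
    by move=> x [_ /= fx]; rewrite subr_eq0 eq_sym lt_eqF.
  exact: onem.
- apply: Ck_on_eq (@Ck_on_cst R _ R i U2 0) => // x [_ /= fx].
  by rewrite triangle_ge // ltW.
Qed.

Lemma triangle_Cc_infty F G : Cc_infty S F -> Cc_infty S G ->
  Cc_infty S (triangle F G).
Proof.
move=> [Fs _] [Gs Gc]; split; first exact: triangle_smooth_fun.
apply: compact_support_sub Gc _ => p Gp.
by have [_ _ _ u0 _] := uP; rewrite /triangle Gp mul0r (u0 0) ?mulr0 // ltW.
Qed.

(** The bound on b rests on the mean value estimate 1 - u(F) <= k (1 - F). Only b is bounded, since
    a gets multiplied by 0 in the determinant with u(F). *)
Lemma diff_triangle F G c x : smooth_fun S F -> smooth_fun S G ->
  charts S c -> cod c x ->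
  exists a b, 0 <= b <= k ^+ 2 /\
    forall v, 'd (triangle F G \o of_vec c) x v =
      a * 'd (F \o of_vec c) x v + b * 'd (G \o of_vec c) x v.
Proof.
move=> Fs Gs cS cx; have [_ uD u'k _ u1] := uP.
have tri := smooth_fun_differentiable (triangle_smooth_fun Fs Gs) cS cx.
have fx := smooth_fun_differentiable Fs cS cx.
have gx := smooth_fun_differentiable Gs cS cx.
have k0 := cutoff_ge0.
set f := F \o of_vec c in fx *; set g := G \o of_vec c in gx *.
have [f1|f1] := ltP (f x) 1; last first.
  (* Near a point with F >= 1 one has F > 1 - d, so the function vanishes identically there. *)
  exists 0, 0; split=> [|v]; first by rewrite lexx exprn_ge0.
  rewrite !mul0r addr0 -deriveE // -(derive_cst (0 : R) x v).
  apply: near_eq_derive.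
  have : nbhs x (cod c `&` f @^-1` [set y | 1 - d < y]).
    apply: open_nbhs_nbhs; split; last first.
      by split=> //=; apply: lt_le_trans f1; rewrite gtrBl.
    by apply: open_preimage_on; [apply: (Fs c cS 0%N)|exact: open_gt].
  by apply: filterS => y [_ /= fy]; rewrite triangle_ge // ltW.
have f1n : 1 - f x != 0 by rewrite gt_eqF // subr_gt0.
pose q y := g y / (1 - f y).
have dv1f : differentiable (fun y => 1 - f y) x.
  exact: differentiable_onem.
have dV : differentiable (fun y => (1 - f y)^-1) x by apply: differentiableV.
have dq : differentiable q x by apply: differentiableM.
have duq : differentiable (u \o q) x.
  by apply: differentiable_comp => //; exact: cutoff_differentiable.
have duf : differentiable (u \o f) x.
  by apply: differentiable_comp => //; exact: cutoff_differentiable.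
have d1uf : differentiable (fun y => 1 - (u \o f) y) x.
  exact: differentiable_onem.
(* Product and quotient rules: dF enters through the quotient and through the factor 1 - u(F), dG
   through the quotient alone. *)
exists ((1 - u (f x)) * (u' (q x) * (g x * (1 - f x) ^- 2)) - u (q x) * u' (f x)).
exists ((1 - u (f x)) * u' (q x) * (1 - f x)^-1); split.
  have /andP[q0 qk] := u'k (q x).
  have /andP[_ uf1] := cutoff01 uP (f x).
  have := derive_bounds_incr uD u'k (ltW f1).
  rewrite (u1 1) ?gerBl ?(ltW d_gt0) // => /andP[u0 ufk].
  rewrite !mulr_ge0 ?invr_ge0 ?subr_ge0 ?(ltW f1) //=.
  rewrite ler_pdivrMr ?subr_gt0 // expr2 mulrAC ler_pM //.
move=> v; rewrite -!deriveE //.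
have -> : triangle F G \o of_vec c = (fun y => 1 - (u \o f) y) * (u \o q) by [].
rewrite deriveM; [|exact: diff_derivable|exact: diff_derivable].
rewrite (@derive_comp _ _ q) //; last exact: cutoff_differentiable.
have -> : 'D_v (fun y => 1 - (u \o f) y) x = - (u' (f x) * 'D_v f x).
  rewrite derive_onem // derive_comp //; last exact: cutoff_differentiable.
  by rewrite cutoff_derive.
have -> : 'D_v q x = g x * ((1 - f x) ^- 2 * 'D_v f x) + (1 - f x)^-1 * 'D_v g x.
  rewrite (@deriveM _ _ g (fun y => (1 - f y)^-1));
    [|exact: diff_derivable|exact: diff_derivable].
  rewrite deriveV //; last exact: diff_derivable.
  by rewrite derive_onem // scalerN scaleNr opprK.
rewrite cutoff_derive /GRing.scale /=; ring.
Qed.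

(** The coefficient matrix is triangular, as the differential of u(F) involves dF only; its
    determinant u'(F) b is at most k k^2. *)
Lemma poisson_triangle F G p : smooth_fun S F -> smooth_fun S G ->
  `|poisson om (u \o F) (triangle F G) p| <= k ^+ 3 * `|poisson om F G p|.
Proof.
move=> Fs Gs; set c := chart_at S p; set x := to_vec c p.
have cS : charts S c := charts_chart_at S p.
have cx : cod c x := to_vec_cod (dom_chart_at S p).
have [a [b [/andP[b0 bk] dtri]]] := diff_triangle Fs Gs cS cx.
rewrite (@poisson_lincomb F G _ _ p (u' (F (of_vec c x))) 0 a b) //.
- rewrite mulr0 subr0 normrM ler_wpM2r //.
  have [_ _ u'k _ _] := uP; have /andP[F0 Fk] := u'k (F (of_vec c x)).
  by rewrite normrM !ger0_norm // exprS ler_pM.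
- move=> v; rewrite mul0r addr0.
  exact: (diff_cutoff _ (smooth_fun_differentiable Fs cS cx)).
Qed.

End Rearrangement.

(** * Comparison of the infima over the two classes of pairs *)

Section PoissonInfimum.
Variables (R : realType) (n : nat) (M : topologicalType).
Variables (S : smooth_manifold R n M) (om : symplectic_form S).
Implicit Types (F G : M -> R) (A B : set ((M -> R) * (M -> R))).

(** Inclusion gives one inequality. For the other, each pair of A is replaced by pairs of B at the
    cost of a factor arbitrarily close to 1. *)
Lemma inf_poisson_eq A B : B `<=` A ->
  (forall FG (t : R), A FG -> 0 < t <= 1 -> exists2 FG', B FG' &
    forall p, `|poisson om FG'.1 FG'.2 p| <=
      (1 + t) ^+ 3 * `|poisson om FG.1 FG.2 p|) ->
  inf_poisson om A = inf_poisson om B.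
Proof.
move=> BA AB; apply/eqP; rewrite eq_le; apply/andP; split.
  by apply: ereal_inf_le_tmp; exact: image_subset.
apply: le_ereal_inf_tmp => _ [FG AFG <-].
set s := sup_norm _; have sE p : (`|poisson om FG.1 FG.2 p|%:E <= s)%E.
  by apply: ereal_sup_ubound; exists p.
apply/lee_addgt0Pr => e e0.
(* [r0] is the norm when it is finite and nonnegative. The value 0 stands in when it is infinite, or
   negative, where no point p exists. *)
have [r0 [r00 rs]] : exists r : R, 0 <= r /\
    (s = +oo%E \/ forall p, `|poisson om FG.1 FG.2 p| <= r /\ (r%:E <= s)%E).
  case: s sE => [r|_|sE].
  - have [r0|r0] := leP 0 r => sE; first by exists r; split=> //; right=> p; rewrite lexx -lee_fin sE.
    exists 0; split=> //; right=> p; have := sE p; rewrite lee_fin => /le_lt_trans.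
    by move=> /(_ _ r0); rewrite ltNge normr_ge0.
  - by exists 0; split=> //; left.
  - by exists 0; split=> //; right=> p; have := sE p.
have r1 : 0 < 7 * (r0 + 1) by rewrite mulr_gt0 // ltr_wpDl.
(* On [0, 1] one has (1 + t)^3 <= 1 + 7t, so 7 t r0 <= e suffices; [r0 + 1] avoids dividing by 0. *)
pose t := Num.min 1 (e / (7 * (r0 + 1))).
have t0 : 0 < t by rewrite lt_min ltr01 divr_gt0.
have t1 : t <= 1 by rewrite ge_min lexx.
have te : t * (7 * (r0 + 1)) <= e by rewrite -ler_pdivlMr // ge_min lexx orbT.
have [FG' BFG' FG'p] := AB FG t AFG (introT andP (conj t0 t1)).
apply: (@le_trans _ _ (sup_norm (poisson om FG'.1 FG'.2))).
  by apply: ereal_inf_lbound; exists FG'.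
case: rs => [->|rs]; first by rewrite leey.
apply: ge_ereal_sup => _ [p _ <-]; have [pr rs'] := rs p.
apply: (@le_trans _ _ (r0%:E + e%:E)%E); last exact: leeD2r.
rewrite -EFinD lee_fin; apply: le_trans (FG'p p) _.
apply: (@le_trans _ _ ((1 + t) ^+ 3 * r0)).
  by rewrite ler_wpM2l // exprn_ge0 // addr_ge0 // ltW.
have t3 : (1 + t) ^+ 3 <= 1 + 7 * t by nra.
apply: (@le_trans _ _ ((1 + 7 * t) * r0)); first by rewrite ler_wpM2r.
by nra.
Qed.

Lemma F3'_sub (X Y Z : set M) : F3' S X Y Z `<=` F3 S X Y Z.
Proof.
move=> FG [FC GC _ [nX nY] nZ]; split=> // p.
- by move=> /nX /nbhs_singleton /= ->.
- by move=> /nY /nbhs_singleton /= ->.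
- by move=> /nZ /nbhs_singleton /= ->.
Qed.

Lemma F4'_sub (X0 X1 Y0 Y1 : set M) : F4' S X0 X1 Y0 Y1 `<=` F4 S X0 X1 Y0 Y1.
Proof.
move=> FG [FC GC _ [nX0 nX1] [nY0 nY1]]; split=> //; [split| |] => p.
- by move=> /nX0 /nbhs_singleton /= ->.
- by move=> /nX1 /nbhs_singleton /= ->.
- by move=> /nY0 /nbhs_singleton /= ->.
- by move=> /nY1 /nbhs_singleton /= ->.
Qed.

Variables (k d : R) (u u' : R -> R).
Hypotheses (d_gt0 : 0 < d) (uP : cutoff k d u u').

Lemma cutoff_near0 F p : continuous F -> F p <= 0 -> \forall q \near p, u (F q) = 0.
Proof.
have [_ _ _ u0 _] := uP; move=> Fc Fp.
apply: filterS (cvgr_lt (F p) (Fc p) _ (le_lt_trans Fp d_gt0)) => q /ltW.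
exact: u0.
Qed.

Lemma cutoff_near1 F p : continuous F -> 1 <= F p -> \forall q \near p, u (F q) = 1.
Proof.
have [_ _ _ _ u1] := uP; move=> Fc Fp.
have Fpd : 1 - d < F p by apply: lt_le_trans Fp; rewrite gtrBl.
by apply: filterS (cvgr_gt (F p) (Fc p) _ Fpd) => q /ltW; exact: u1.
Qed.

Lemma F4_cutoff (X0 X1 Y0 Y1 : set M) F G : F4 S X0 X1 Y0 Y1 (F, G) ->
  F4' S X0 X1 Y0 Y1 (u \o F, u \o G).
Proof.
move=> [/= FC GC [FX0 FX1] GY0 GY1]; have [[Fs _] [Gs _]] := (FC, GC).
have [Fc Gc] := (smooth_fun_continuous Fs, smooth_fun_continuous Gs).
split=> /=; [exact: cutoff_Cc_infty d_gt0 uP _ FC|exact: cutoff_Cc_infty d_gt0 uP _ GC| | |].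
- by move=> p; split; exact: cutoff01 uP _.
- by split=> p; [move=> /FX0; exact: cutoff_near0|move=> /FX1; exact: cutoff_near1].
- by split=> p; [move=> /GY0; exact: cutoff_near0|move=> /GY1; exact: cutoff_near1].
Qed.

Lemma F3_triangle (X Y Z : set M) F G : F3 S X Y Z (F, G) ->
  F3' S X Y Z (u \o F, triangle u F G).
Proof.
move=> [/= FC GC FX GY FGZ]; have [[Fs _] [Gs _]] := (FC, GC).
have [Fc Gc] := (smooth_fun_continuous Fs, smooth_fun_continuous Gs).
(* The conditions of [triangle_eq0] and [triangle_sum] read G + d F < d and G + (1 - d) F > 1 - d,
   with continuous left sides. *)
have FGc (a : R) : continuous (fun q => G q + a * F q).
  by move=> q; exact: cvgD (Gc q) (cvgM (cvg_cst a) (Fc q)).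
have near1 p : 1 <= F p -> \forall q \near p, 1 - d <= F q.
  move=> F1; have Fpd : 1 - d < F p by apply: lt_le_trans F1; rewrite gtrBl.
  by apply: filterS (cvgr_gt (F p) (Fc p) _ Fpd) => q /ltW.
split=> /=.
- exact: cutoff_Cc_infty d_gt0 uP _ FC.
- exact: triangle_Cc_infty d_gt0 uP _ _ FC GC.
- move=> p; have /andP[T0 T1] := triangle_bounds uP F G p.
  have /andP[u0 u1] := cutoff01 uP (F p).
  by rewrite u0 T0 -lerBrDl.
- split=> p; first by move=> /FX; exact: cutoff_near0.
  move=> /GY Gp; have [F1|F1] := ltP (F p) 1; last first.
    by apply: filterS (near1 p F1) => q Fq; apply: (triangle_eq0 d_gt0 uP); right.
  (* From G <= 0 and F < 1. *)
  have H : G p + d * F p < d by move: d_gt0 => d0; nra.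
  apply: filterS (cvgr_lt _ (FGc d p) _ H) => q Hq.
  by apply: (triangle_eq0 d_gt0 uP); left; lra.
- move=> p /FGZ FGp; have [F1|F1] := ltP (F p) 1; last first.
    by apply: filterS (near1 p F1) => q Fq; apply: (triangle_sum d_gt0 uP); right.
  (* From F + G >= 1 the right side is at least 1 - d F, which exceeds 1 - d as F < 1. *)
  have H : 1 - d < G p + (1 - d) * F p by move: d_gt0 => d0; nra.
  apply: filterS (cvgr_gt _ (FGc (1 - d) p) _ H) => q Hq.
  by apply: (triangle_sum d_gt0 uP); left; lra.
Qed.

End PoissonInfimum.

Theorem proposition1p3 (R : realType) (n : nat) (M : topologicalType)
    (S : smooth_manifold R n M) (om : symplectic_form S)
    (Mconn : connected [set: M]) :
  (forall X Y Z : set M, compact X -> compact Y -> compact Z ->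
     X `&` Y `&` Z = set0 ->
     pb3 om X Y Z = inf_poisson om (F3' S X Y Z)) /\
  (forall X0 X1 Y0 Y1 : set M,
     compact X0 -> compact X1 -> compact Y0 -> compact Y1 ->
     X0 `&` X1 = set0 -> Y0 `&` Y1 = set0 ->
     pb4 om X0 X1 Y0 Y1 = inf_poisson om (F4' S X0 X1 Y0 Y1)).
Proof.
split=> [X Y Z _ _ _ _|X0 X1 Y0 Y1 _ _ _ _ _ _].
- apply: inf_poisson_eq => [|[F G] t FG t01]; first exact: F3'_sub.
  have [d [u [u' [d0 uP]]]] := exists_cutoff t01.
  exists (u \o F, triangle u F G); first exact: (F3_triangle d0 uP FG).
  by have [[Fs _] [Gs _] _ _ _] := FG => p; exact: (poisson_triangle om d0 uP p Fs Gs).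
- apply: inf_poisson_eq => [|[F G] t FG t01]; first exact: F4'_sub.
  have [d [u [u' [d0 uP]]]] := exists_cutoff t01.
  exists (u \o F, u \o G); first exact: (F4_cutoff d0 uP FG).
  have [[Fs _] [Gs _] _ _ _] := FG => p.
  (* The factor here is (1 + t)^2, raised to the cube that the common comparison expects. *)
  apply: (le_trans (poisson_cutoff om uP p Fs Gs)).
  case/andP: t01 => t0 _; have t1 : 1 <= 1 + t by rewrite lerDl ltW.
  by rewrite ler_wpM2r // ler_weXn2l.
Qed.
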